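(* Let $F\subset\mathbb R^d$ be a boundary set. Let $\mathbb P$ be a measure on $\mathbb R^d$ with density $f\ge0$ w.r.t. $\mu_d$, and suppose there is a bounded measurable function $\bar f\ge0$ on $F$ with $$\frac1\varepsilon\int_{\mathbb R^d}\mathbf 1\{d_F(z)\le\varepsilon\}\,|f(z)-\bar f(p_F(z))|\,\mu_d(dz)\to0\quad(\varepsilon\to0^+),$$ and such that $(x,u)\mapsto\bar f(x)$ is integrable with respect to $|\Theta_i|(F,\cdot)$ on $\mathrm{Nor}(F)$ for $i=0,\dots,d-1$. Define $\mathbb Q(d(s,x,u))=ds\times\bar f(x)\,\Theta_{d-1}(F,d(x,u))$ on $\Sigma(F)$. Let $T>0$ and let $F(\varepsilon)$, $0\le\varepsilon\le1$, be Borel sets with $F(0)\subset F$ and $F(\varepsilon)\subset F_{\varepsilon T}$, which are differentiable at $F$ with a derivative $B\subset\Sigma_T(F)$. Then $\lim_{\varepsilon\to0^+}\frac{\mathbb P(F(\varepsilon))-\mathbb P(F(0))}{\varepsilon}$ exists and equals $\mathbb Q(B)$.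
   Context: Notation: $\mu_d$ is Lebesgue measure on $\mathbb R^d$, $\mu_1$ Lebesgue measure on $\mathbb R$, $S^{d-1}$ the unit sphere, $a\wedge b=\min(a,b)$. For a nonempty closed set $G\subset\mathbb R^d$ and $z\in\mathbb R^d$: $d_G(z)=\min_{x\in G}\|z-x\|$; the skeleton $S_G$ is the set of points having more than one nearest point in $G$; for $z\notin S_G$, $p_G(z)$ is the unique nearest point; for $z\notin S_G\cup G$, $u_G(z)=(z-p_G(z))/d_G(z)$. The normal bundle is $\mathrm{Nor}(G)=\{(p_G(z),u_G(z)):z\in\mathbb R^d\setminus(S_G\cup G)\}\subset\partial G\times S^{d-1}$ and the reach function is $r_G(x,u)=\sup\{s>0:p_G(x+su)=x\}\in(0,\infty]$. For $\varepsilon>0$, $G_\varepsilon=\{z:d_G(z)\le\varepsilon\}$. Support measures (Hug–Last–Weil local Steiner formula): there are uniquely determined set functions $\Theta_0(G,\cdot),\dots,\Theta_{d-1}(G,\cdot)$, defined on Borel sets $A\subset\mathrm{Nor}(G)$ contained in some $\{(x,u):\max(\|x\|,r_G(x,u)^{-1})\le c\}$, $c<\infty$, which are signed measures of finite variation on each such sublevel set, whose total variation measures $|\Theta_i|(G,\cdot)$ (extended to all Borel subsets of $\mathrm{Nor}(G)$) satisfy $\int\mathbf 1_K(x)(r_G(x,u)\wedge c)^{d-i}|\Theta_i|(G,d(x,u))<\infty$ for all compact $K$ and $c>0$, and such that for every bounded measurable $f$ with compact support $\int_{\mathbb R^d\setminus G}f\,d\mu_d=\sum_{j=1}^d\binom{d-1}{j-1}\int_{\mathrm{Nor}(G)}\int_0^{r_G(x,u)}f(x+tu)t^{j-1}\,dt\,\Theta_{d-j}(G,d(x,u))$.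 $\Theta_{d-1}(G,\cdot)$ is a nonnegative $\sigma$-finite measure. Boundary sets: a boundary set is a nonempty compact $F\subset\mathbb R^d$ with empty interior and $\mu_d(F)=0$. Its normal cylinder is $\Sigma(F)=\mathbb R\times\mathrm{Nor}(F)$, $\Sigma_T(F)=\{(t,x,u)\in\Sigma(F):|t|\le T\}$, and $M_F=\mu_1\otimes\Theta_{d-1}(F,\cdot)$. For $\varepsilon>0$ the local magnification map is $\tau_\varepsilon(z)=(d_F(z)/\varepsilon,p_F(z),u_F(z))$ for $z\notin F\cup S_F$, and $\tau_\varepsilon(A)=\{\tau_\varepsilon(z):z\in A\setminus(F\cup S_F)\}$ for Borel $A$. A family $F(\varepsilon)$, $0\le\varepsilon\le1$, of bounded Borel sets with $F(0)\subset F$ is differentiable at $F$ with derivative $B$ (a Borel subset of $\Sigma(F)$) if there is $T>0$ with $\varepsilon^{-1}\mu_d(F(\varepsilon)\setminus F_{\varepsilon T})\to0$ and $M_F(\tau_\varepsilon(F(\varepsilon))\triangle B)\to0$ as $\varepsilon\to0^+$. *)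

(* Defs.v *)
From HB Require Import structures.
From mathcomp Require Import all_boot all_order all_algebra.
From mathcomp Require Import all_classical all_reals all_analysis.
Set Implicit Arguments. Unset Strict Implicit. Unset Printing Implicit Defensive.
Import Order.TTheory GRing.Theory Num.Theory.
Import numFieldNormedType.Exports.
Local Open Scope classical_set_scope.
Local Open Scope ring_scope.

Section Geometry.
Variables (R : realType) (d : nat).
Local Notation P := 'rV[R]_d.

(* Euclidean space R^d with its Borel sigma-algebra (generated by the open
   sets of the (product = Euclidean) topology on row vectors). *)
Definition Rd := g_sigma_algebraType (@open P).

(* Euclidean norm (the library norm on 'rV is the sup norm). *)
Definition enorm (z : P) : R := Num.sqrt (\sum_(i < d) z ord0 i ^+ 2).

(* d_G(z) = min_{x in G} ||z - x|| (= inf for nonempty closed G). *)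
Definition dist_set (G : set P) (z : P) : R := inf [set enorm (z - x) | x in G].

Definition skel (G : set P) : set P :=
  [set z | exists x y, G x /\ G y /\ x <> y /\
           enorm (z - x) = dist_set G z /\ enorm (z - y) = dist_set G z].

(* p_G(z): the (unique, for z not in S_G) nearest point *)
Definition nearest_pt (G : set P) (z : P) : P :=
  xget 0 [set x | G x /\ enorm (z - x) = dist_set G z].

Definition unitv (G : set P) (z : P) : P := (dist_set G z)^-1 *: (z - nearest_pt G z).

Definition Nor (G : set P) : set (P * P) :=
  [set (nearest_pt G z, unitv G z) | z in ~` (G `|` skel G)].

Definition reach (G : set P) (x u : P) : \bar R :=
  ereal_sup [set s%:E | s in [set s : R | 0 < s /\ ~ skel G (x + s *: u)
                                          /\ nearest_pt G (x + s *: u) = x]].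

Definition parallel (G : set P) (eps : R) : set P := [set z | dist_set G z <= eps].

Definition is_lebesgue (mu : {measure set Rd -> \bar R}) : Prop :=
  forall a b : P, (forall i, a ord0 i <= b ord0 i) ->
    mu [set z : P | forall i, a ord0 i <= z ord0 i <= b ord0 i]
    = (\prod_(i < d) (b ord0 i - a ord0 i))%:E.

Definition boundary_set (mu : {measure set Rd -> \bar R}) (F : set P) : Prop :=
  F !=set0 /\ compact F /\ interior F = set0 /\ mu F = 0%E.

(* Support measures Theta_0..Theta_{d-1} of G, each given by its Jordan
   decomposition Theta_i = thP i - thN i (thP i, thN i mutually singular
   measures concentrated on Nor(G)); |Theta_i| = thP i + thN i. *)
Definition support_measures (mu : {measure set Rd -> \bar R}) (G : set P)
  (thP thN : nat -> {measure set (Rd * Rd)%type -> \bar R}) : Prop :=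
  (forall i, (i < d)%N ->
    (forall A : set (Rd * Rd)%type, measurable A -> A `&` Nor G = set0 -> thP i A = 0%E /\ thN i A = 0%E)
    /\ (exists A : set (Rd * Rd)%type, measurable A /\ thP i (~` A) = 0%E /\ thN i A = 0%E)
    /\ (forall c : R, 0 < c -> forall A : set (Rd * Rd)%type, measurable A ->
          A `<=` [set xu | Nor G xu /\ enorm xu.1 <= c /\ ((c^-1)%:E <= reach G xu.1 xu.2)%E] ->
          (thP i A < +oo)%E /\ (thN i A < +oo)%E)
    /\ (forall (K : set P) (c : R), compact K -> 0 < c ->
          let g := fun xu : P * P =>
            ((\1_K xu.1) * (fine (Order.min (reach G xu.1 xu.2) c%:E)) ^+ (d - i))%:E in
          (\int[thP i]_(xu in Nor G) g xu < +oo)%E /\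
          (\int[thN i]_(xu in Nor G) g xu < +oo)%E))
  /\ (forall A : set (Rd * Rd)%type, measurable A -> thN d.-1 A = 0%E)
  /\ (forall f : P -> R, measurable_fun (setT : set Rd) f ->
        (exists M, forall z, `|f z| <= M) ->
        (exists K : set P, compact K /\ forall z, ~ K z -> f z = 0) ->
        let g := fun (j : nat) (xu : P * P) =>
          (\int[@lebesgue_measure R]_(t in [set t : R | (0 < t)%R /\ (t%:E < reach G xu.1 xu.2)%E])
             (f (xu.1 + (t : R) *: xu.2) * (t : R) ^+ (j - 1))%:E)%E in
        (\int[mu]_(z in ~` G) (f z)%:E =
         \sum_(1 <= j < d.+1)
            ((('C(d - 1, j - 1))%:R)%:E *
             (\int[thP (d - j)%N]_(xu in Nor G) g j xu
              - \int[thN (d - j)%N]_(xu in Nor G) g j xu)))%E).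

Definition SigmaT (F : set P) (T : R) : set (R * (Rd * Rd)) :=
  [set stu | `|stu.1| <= T /\ Nor F stu.2].

(* M_F = mu_1 (x) Theta_{d-1}(F, .) (as iterated integral) *)
Definition MF (th : {measure set (Rd * Rd)%type -> \bar R})
  (C : set (R * (Rd * Rd))) : \bar R :=
  \int[th]_(xu in setT) (@lebesgue_measure R) [set s | C (s, xu)].

Definition tau (F : set P) (eps : R) (A : set P) : set (R * (Rd * Rd)) :=
  [set (dist_set F z / eps, (nearest_pt F z, unitv F z)) | z in A `\` (F `|` skel F)].

Definition set_differentiable (mu : {measure set Rd -> \bar R})
  (th : {measure set (Rd * Rd)%type -> \bar R})
  (F : set P) (Fam : R -> set P) (B : set (R * (Rd * Rd))) : Prop :=
  exists T : R, 0 < T /\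
    ((fun e : R => ((e^-1)%:E * mu (Fam e `\` parallel F (e * T)))%E) @ 0^'+ --> 0%E) /\
    ((fun e : R => MF th ((tau F e (Fam e) `\` B) `|` (B `\` tau F e (Fam e)))) @ 0^'+ --> 0%E).

Definition Qmeas (th : {measure set (Rd * Rd)%type -> \bar R}) (fbar : P -> R)
  (B : set (R * (Rd * Rd))) : \bar R :=
  \int[th]_(xu in setT) ((fbar xu.1)%:E * (@lebesgue_measure R) [set s | B (s, xu)])%E.

End Geometry.

(* Main.v *)
Require Import Defs.
From HB Require Import structures.
From mathcomp Require Import all_boot all_order all_algebra.
From mathcomp Require Import all_classical all_reals all_analysis.
From mathcomp Require Import measurable_realfun ring lra.
Import Order.TTheory GRing.Theory Num.Theory.
Import numFieldNormedType.Exports.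
Local Open Scope classical_set_scope.
Local Open Scope ring_scope.

(* Applied to [fbar \o nearest_pt F] restricted to [Fam e], the local Steiner
   formula is a polynomial in the distance.  Its term of order [j = 1] is, after
   the substitution [t = e s], exactly [e] times the [Q]-measure of
   [tau F e (Fam e)], while a term of order [j >= 2] is [O(e ^ j)] because the
   radial variable is at most [e T] on [Fam e] and [fbar] is integrable for
   every support measure.  Replacing [f] by [fbar \o nearest_pt F] costs [o(e)]
   by hypothesis, and [Q] is dominated by [sup fbar] times [MF], so the
   [Q]-measure of [tau F e (Fam e)] tends to that of [B]. *)

Set Implicit Arguments.
Unset Strict Implicit.

(** * Euclidean geometry of the nearest-point map *)

Section EuclideanNorm.
Context {R : realType} {d : nat}.
Implicit Types (x y z u : 'rV[R]_d) (G : set 'rV[R]_d).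

(** The exact first-order term rests on inverting [tau F e] by (s, x, u) -> x + (e s) u: membership
    in an image becomes a condition on (s, x, u), in which [e] and [s] occur only through their
    product. Two sets stand in the way of the identity: the endpoint t = reach of each ray, which
    the Steiner formula leaves out and which costs one point per ray, and the skeleton, where
    [nearest_pt] is an arbitrary choice. Borel measurability of the skeleton, of [nearest_pt] and of
    the normal bundle has to be earned, each time by reducing an uncountable union to a countable
    one. The negative part of the support measure of order d - 1 vanishes, so the first-order term
    is a single nonnegative integral; the other terms are differences, made meaningful by the
    integrability of [fbar] for both parts. As [MF] and [Qmeas] are iterated integrals, sets are
    compared section by section over a fixed (x, u), and all estimates are made in the extended
    reals. *)

Lemma sum_sqr_ge0 (I : finType) (a : I -> R) : 0 <= \sum_i a i ^+ 2.
Proof. by apply: sumr_ge0 => i _; exact: sqr_ge0. Qed.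

Lemma enorm_ge0 z : 0 <= enorm z.
Proof. exact: sqrtr_ge0. Qed.

Lemma enorm_sqr z : enorm z ^+ 2 = \sum_(i < d) z ord0 i ^+ 2.
Proof. by rewrite /enorm sqr_sqrtr ?sum_sqr_ge0. Qed.

Lemma enorm_coord z i : `|z ord0 i| <= enorm z.
Proof.
rewrite -sqrtr_sqr ler_wsqrtr// (bigD1 i)//= lerDl.
by apply: sumr_ge0 => j _; exact: sqr_ge0.
Qed.

Lemma enorm0 : enorm (0 : 'rV[R]_d) = 0.
Proof.
by rewrite /enorm big1 ?sqrtr0// => i _; rewrite mxE expr0n.
Qed.

Lemma enorm_eq0 z : enorm z = 0 -> z = 0.
Proof.
move=> z0; apply/rowP => i; rewrite mxE; apply/eqP; rewrite -normr_le0.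
by rewrite -z0 enorm_coord.
Qed.

Lemma enormZ (a : R) z : enorm (a *: z) = `|a| * enorm z.
Proof.
rewrite /enorm -sqrtr_sqr -sqrtrM ?sqr_ge0//; congr Num.sqrt.
by rewrite mulr_sumr; apply: eq_bigr => i _; rewrite mxE exprMn.
Qed.

Lemma enormN z : enorm (- z) = enorm z.
Proof. by rewrite -scaleN1r enormZ normrN1 mul1r. Qed.

Lemma enorm_distC x y : enorm (x - y) = enorm (y - x).
Proof. by rewrite -enormN opprB. Qed.

Lemma enorm_cauchy_schwarz x y :
  \sum_(i < d) x ord0 i * y ord0 i <= enorm x * enorm y.
Proof.
have [x0|xn0] := eqVneq (enorm x) 0.
  rewrite x0 mul0r (enorm_eq0 x0) big1// => i _; by rewrite mxE mul0r.
have [y0|yn0] := eqVneq (enorm y) 0.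
  rewrite y0 mulr0 (enorm_eq0 y0) big1// => i _; by rewrite mxE mulr0.
have xp : 0 < enorm x by rewrite lt_neqAle eq_sym xn0 enorm_ge0.
have yp : 0 < enorm y by rewrite lt_neqAle eq_sym yn0 enorm_ge0.
set S := \sum_(i < d) _.
(* Expanded, this sum of squares is 2 |x| |y| (|x| |y| - S); cancelling the factor 2 |x| |y| is why
   the zero norms were split off. *)
have : 0 <= \sum_(i < d) (enorm y * x ord0 i - enorm x * y ord0 i) ^+ 2.
  exact: sum_sqr_ge0.
have -> : \sum_(i < d) (enorm y * x ord0 i - enorm x * y ord0 i) ^+ 2 =
  enorm y ^+ 2 * (\sum_(i < d) x ord0 i ^+ 2) - 2 * enorm x * enorm y * S
  + enorm x ^+ 2 * (\sum_(i < d) y ord0 i ^+ 2).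
  rewrite /S !mulr_sumr -sumrN -!big_split/=.
  by apply: eq_bigr => i _; ring.
rewrite -!enorm_sqr => h.
have : 0 <= (2 * enorm x * enorm y) * (enorm x * enorm y - S).
  by apply: le_trans h _; rewrite le_eqVlt; apply/orP; left; apply/eqP; ring.
by rewrite pmulr_rge0 ?subr_ge0// !mulr_gt0.
Qed.

Lemma enormD x y : enorm (x + y) <= enorm x + enorm y.
Proof.
rewrite -(@ler_pXn2r _ 2)// ?nnegrE ?addr_ge0 ?enorm_ge0//.
rewrite enorm_sqr.
have -> : \sum_(i < d) (x + y) ord0 i ^+ 2 =
  enorm x ^+ 2 + 2 * (\sum_(i < d) x ord0 i * y ord0 i) + enorm y ^+ 2.
  rewrite !enorm_sqr mulr_sumr -!big_split/=.
  by apply: eq_bigr => i _; rewrite mxE; ring.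
have := enorm_cauchy_schwarz x y; nra.
Qed.

Lemma enorm_triangle y x z : enorm (x - z) <= enorm (x - y) + enorm (y - z).
Proof. by rewrite -{1}(subrK y x) -addrA enormD. Qed.

Lemma continuous_sum_sqr (s : seq 'I_d) :
  continuous (fun z : 'rV[R]_d => \sum_(i <- s) z ord0 i ^+ 2).
Proof.
elim: s => [|i s IH].
  under eq_fun do rewrite big_nil; exact: cst_continuous.
under eq_fun do rewrite big_cons.
move=> z; have zi := @coord_continuous R 1 d ord0 i z.
exact: (cvgD (cvgM zi zi) (IH z)).
Qed.

Lemma continuous_enorm : continuous (@enorm R d).
Proof.
move=> z; exact: (continuous_comp (@continuous_sum_sqr (index_enum _) z)
  (@sqrt_continuous R _)).
Qed.

Lemma continuous_enorm_sub z : continuous (fun x => enorm (z - x)).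
Proof.
move=> x; have zx : {for x, continuous (fun w : 'rV[R]_d => z - w)}.
  exact: (@cvgB _ _ _ (nbhs x) _ _ _ _ _ (cvg_cst z) (@cvg_id _ (nbhs x))).
exact: (continuous_comp zx (@continuous_enorm _)).
Qed.

Lemma enorm_dist_has_inf G z : G !=set0 ->
  has_inf [set enorm (z - x) | x in G].
Proof.
move=> [x Gx]; split; first by exists (enorm (z - x)); exists x.
by exists 0 => _ [y _ <-]; exact: enorm_ge0.
Qed.

Lemma dist_set_le G z x : G x -> dist_set G z <= enorm (z - x).
Proof.
move=> Gx; apply: ge_inf; last by exists x.
by apply: (enorm_dist_has_inf z _).2; exists x.
Qed.

Lemma dist_set_ge0 G z : G !=set0 -> 0 <= dist_set G z.
Proof.
move=> G0; apply: lb_le_inf; first exact: (enorm_dist_has_inf z G0).1.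
by move=> _ [y _ <-]; exact: enorm_ge0.
Qed.

Lemma dist_set_lip G x y : G !=set0 ->
  dist_set G x <= enorm (x - y) + dist_set G y.
Proof.
move=> G0; rewrite -lerBlDl; apply: lb_le_inf.
  exact: (enorm_dist_has_inf y G0).1.
move=> _ [w Gw <-]; rewrite lerBlDl.
exact: le_trans (dist_set_le x Gw) (enorm_triangle _ _ _).
Qed.

Lemma continuous_dist_set G : G !=set0 -> continuous (dist_set G).
Proof.
move=> G0 z; apply/(@cvgrPdist_lt _ _ _ (nbhs z)) => e e0.
have := @continuous_enorm_sub z z.
rewrite /continuous_at subrr enorm0 => /cvgrPdist_lt/(_ e e0).
apply: filterS => w; rewrite sub0r normrN ger0_norm ?enorm_ge0//.
apply: le_lt_trans; rewrite ler_norml; apply/andP; split.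
  by rewrite lerNl opprB lerBlDr enorm_distC dist_set_lip.
by rewrite lerBlDr dist_set_lip.
Qed.

Lemma dist_set_attained G z : G !=set0 -> compact G ->
  exists2 x, G x & enorm (z - x) = dist_set G z.
Proof.
move=> G0 cG.
have cont : {within G, continuous (fun x => enorm (z - x))}.
  apply: continuous_subspaceT; exact: continuous_enorm_sub.
have [c cG' cmin] := compact_EVT_min G0 cG cont.
move: cG'; rewrite inE => Gc; exists c => //; apply/eqP.
rewrite eq_le dist_set_le// andbT; apply: lb_le_inf.
  exact: (enorm_dist_has_inf z G0).1.
by move=> _ [w Gw <-]; apply: cmin; rewrite inE.
Qed.

Lemma nearest_ptP G z : G !=set0 -> compact G ->
  G (nearest_pt G z) /\ enorm (z - nearest_pt G z) = dist_set G z.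
Proof.
move=> G0 cG; have [x Gx xz] := dist_set_attained z G0 cG.
have h : [set x | G x /\ enorm (z - x) = dist_set G z] x by [].
exact: (xgetPex 0 (ex_intro _ _ h)).
Qed.

Lemma nearest_pt_uniq G z x : G !=set0 -> compact G -> ~ skel G z ->
  G x -> enorm (z - x) = dist_set G z -> nearest_pt G z = x.
Proof.
move=> G0 cG nsk Gx xz; apply: contrapT => ne; apply: nsk.
have [Gp pz] := nearest_ptP z G0 cG.
by exists (nearest_pt G z), x.
Qed.

Lemma dist_set_eq0 G z : G !=set0 -> compact G -> dist_set G z = 0 -> G z.
Proof.
move=> G0 cG z0; have [x Gx] := dist_set_attained z G0 cG.
by rewrite z0 => /enorm_eq0/eqP; rewrite subr_eq0 => /eqP ->.
Qed.

Lemma dist_set_gt0 G z : G !=set0 -> compact G -> ~ G z -> 0 < dist_set G z.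
Proof.
move=> G0 cG nGz; rewrite lt_neqAle dist_set_ge0// andbT eq_sym.
by apply/eqP => /(dist_set_eq0 G0 cG).
Qed.

(** The ball of radius [t] about x + t u lies in the ball of radius [s] about x + s u. By the
    triangle inequality a nearest point of the inner centre is then a nearest point of the outer
    one, which has only one. *)
Lemma nearest_pt_inner G x u s t : G !=set0 -> compact G -> enorm u = 1 ->
  0 <= t <= s -> G x -> ~ skel G (x + s *: u) ->
  dist_set G (x + s *: u) = s ->
  ~ skel G (x + t *: u) /\ dist_set G (x + t *: u) = t.
Proof.
move=> G0 cG u1 /andP[t0 ts] Gx nsk ds.
have shift : enorm ((x + s *: u) - (x + t *: u)) = s - t.
  by rewrite opprD addrACA subrr add0r -scalerBl enormZ u1 mulr1 ger0_norm ?subr_ge0.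
have dt : dist_set G (x + t *: u) = t.
  apply/eqP; rewrite eq_le; apply/andP; split.
    apply: le_trans (dist_set_le _ Gx) _.
    by rewrite addrC addKr enormZ u1 mulr1 ger0_norm.
  have := dist_set_lip (x + s *: u) (x + t *: u) G0; rewrite shift ds; lra.
have key y : G y -> enorm (x + t *: u - y) = t -> y = nearest_pt G (x + s *: u).
  move=> Gy yt; rewrite (nearest_pt_uniq G0 cG nsk Gy)//.
  apply/eqP; rewrite eq_le dist_set_le// andbT ds.
  by have := enorm_triangle (x + t *: u) (x + s *: u) y; rewrite shift yt; lra.
split=> // -[a] [b] [Ga] [Gb] [ab]; rewrite dt => -[/(key a Ga) ea /(key b Gb) eb].
by apply: ab; rewrite ea eb.
Qed.

End EuclideanNorm.

(** * Borel measurability in Rd *)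

Section BorelRd.
Context {R : realType} {d : nat}.
Implicit Types (G C : set 'rV[R]_d).

Lemma open_measurable_Rd C : open C -> measurable (C : set (Rd R d)).
Proof. by move=> oC; exact: sub_sigma_algebra. Qed.

Lemma closed_measurable_Rd C : closed C -> measurable (C : set (Rd R d)).
Proof.
move=> cC; rewrite -(setCK C); apply: measurableC.
by apply: open_measurable_Rd; exact: closed_openC.
Qed.

Lemma continuous_measurable_Rd (f : 'rV[R]_d -> R) : continuous f ->
  measurable_fun (setT : set (Rd R d)) f.
Proof.
move=> cf; apply: (measurability _ (RGenOpens.measurableE R)).
move=> _ [_ [a [b ->]] <-]; rewrite setTI; apply: open_measurable_Rd.
by apply: open_comp => // x _; exact: cf.
Qed.

(** Closed sup-norm cubes with rational centres: a countable family that both generates the topology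
    and separates distinct points. *)
Definition qbox (q : 'rV[rat]_d) (n : nat) : set 'rV[R]_d :=
  [set x | forall i, `|x ord0 i - ratr (q ord0 i)| <= n.+1%:R^-1].

Lemma qbox_cover (x : 'rV[R]_d) n : exists q, qbox q n x.
Proof.
have near_rat (i : 'I_d) : exists q : rat, `|x ord0 i - ratr q| <= n.+1%:R^-1.
  have [q] : exists q : rat, ratr q \in `]x ord0 i, x ord0 i + n.+1%:R^-1[.
    by apply: rat_in_itvoo; rewrite ltrDl invr_gt0.
  rewrite in_itv/= => /andP[xq qx]; exists q.
  by rewrite distrC ger0_norm ?subr_ge0 ?ltW// ltrBlDl.
exists (\row_i sval (cid (near_rat i))) => i.
by rewrite mxE; exact: (svalP (cid (near_rat i))).
Qed.

Lemma closed_qbox q n : closed (qbox q n).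
Proof.
have -> : qbox q n = \bigcap_(i in [set: 'I_d])
    ((fun x : 'rV[R]_d => x ord0 i) @^-1`
      `[ratr (q ord0 i) - n.+1%:R^-1, ratr (q ord0 i) + n.+1%:R^-1]%classic).
  apply/seteqP; split => x /= h.
    move=> i _ /=; rewrite in_itv/=.
    by move: (h i); rewrite ler_distl.
  by move=> i; move: (h i I); rewrite /= in_itv/= ler_distl.
apply: closed_bigI => i _; apply: preimage_closed; last exact: itv_closed.
by move=> x _; exact: coord_continuous.
Qed.

Lemma qbox_diam q n x y i : qbox q n x -> qbox q n y ->
  `|x ord0 i - y ord0 i| <= 2 * n.+1%:R^-1.
Proof.
move=> /(_ i) xq /(_ i) yq; rewrite mulr_natl mulr2n.
apply: le_trans (ler_distD (ratr (q ord0 i)) _ _) _.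
by rewrite lerD// distrC.
Qed.

Lemma natSinv_lt (e : R) : 0 < e -> exists n, 2 * n.+1%:R^-1 < e.
Proof.
move=> e0; have e20 : 0 < e / 2 by rewrite divr_gt0.
have [n] := ltr_add_invr e20; rewrite add0r => h; exists n.
by rewrite mulrC -ltr_pdivlMr.
Qed.

Lemma open_qbox C : open C ->
  C = \bigcup_(qn in [set qn : 'rV[rat]_d * nat | qbox qn.1 qn.2 `<=` C])
        qbox qn.1 qn.2.
Proof.
move=> oC; apply/seteqP; split => [x Cx|x [[q n] /= qnC]]; last exact: qnC.
have /nbhs_ballP[e /= e0 xeC] := open_nbhs_nbhs (conj oC Cx).
have [n ne] := natSinv_lt e0.
have [q qx] := qbox_cover x n.
exists (q, n) => //= y qy; apply: xeC; split => // i j; rewrite !ord1/=.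
exact: le_lt_trans (qbox_diam _ qx qy) ne.
Qed.

(** The Borel sets of [Rd] are generated by the open sets, not by the coordinates; the bridge is
    that an open set is a countable union of cubes, each a finite intersection of coordinate
    conditions. *)
Lemma measurable_fun_Rd dT (T : measurableType dT) (phi : T -> 'rV[R]_d) :
  (forall i, measurable_fun setT (fun t => phi t ord0 i)) ->
  measurable_fun setT (phi : T -> Rd R d).
Proof.
move=> mphi; apply: (@measurability _ _ T (Rd R d) setT phi (@open 'rV[R]_d) erefl).
move=> _ [C oC <-]; rewrite setTI (open_qbox oC) preimage_bigcup bigcup_mkcond.
apply: countable_bigcupT_measurable; first exact: countableP.
move=> [q n] /=; case: ifP => // _.
have -> : phi @^-1` (qbox q n) = \bigcap_(i in [set: 'I_d])
    ((fun t => phi t ord0 i) @^-1`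
      `[ratr (q ord0 i) - n.+1%:R^-1, ratr (q ord0 i) + n.+1%:R^-1]%classic).
  apply/seteqP; split => x /= h.
    move=> i _ /=; rewrite in_itv/=.
    by move: (h i); rewrite ler_distl.
  by move=> i; move: (h i I); rewrite /= in_itv/= ler_distl.
apply: fin_bigcap_measurable => // i _.
by rewrite -[X in measurable X]setTI; exact: mphi.
Qed.

Lemma measurable_coord i : measurable_fun (setT : set (Rd R d)) (fun x : 'rV[R]_d => x ord0 i).
Proof. by apply: continuous_measurable_Rd => x; exact: coord_continuous. Qed.

Lemma measurable_enorm : measurable_fun (setT : set (Rd R d)) (@enorm R d).
Proof. exact: continuous_measurable_Rd continuous_enorm. Qed.

Lemma measurable_dist_set G : G !=set0 ->
  measurable_fun (setT : set (Rd R d)) (dist_set G).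
Proof. by move=> G0; exact: continuous_measurable_Rd (continuous_dist_set G0). Qed.

(** Turns the existence of a nearest point in [C] into an equation between two continuous functions
    of [z]. Nonemptiness is kept because the infimum of the empty set is 0 by convention, which
    would give spurious solutions. *)
Lemma dist_set_subset_eq G (C : set 'rV[R]_d) z : G !=set0 -> compact G -> closed C ->
  (G `&` C !=set0 /\ dist_set (G `&` C) z = dist_set G z) <->
  exists2 x, G x /\ C x & enorm (z - x) = dist_set G z.
Proof.
move=> G0 cG cC; split => [[GC0 <-]|[x [Gx Cx] zx]].
  have cGC : compact (G `&` C) by apply: compact_closedI.
  by have [x [Gx Cx] zx] := dist_set_attained z GC0 cGC; exists x.
have GC0 : G `&` C !=set0 by exists x.
split => //; apply/eqP; rewrite eq_le -{1}zx dist_set_le//=.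
apply: lb_le_inf; first exact: (enorm_dist_has_inf z GC0).1.
by move=> _ [w [Gw _] <-]; exact: dist_set_le.
Qed.

Lemma measurable_nearest_in G (C : set 'rV[R]_d) : G !=set0 -> closed C ->
  measurable ([set z : Rd R d |
    G `&` C !=set0 /\ dist_set (G `&` C) z = dist_set G z]).
Proof.
move=> G0 cC; have [GC0|GC0] := pselect (G `&` C !=set0); last first.
  rewrite (_ : [set _ | _] = set0)//; by apply/seteqP; split => // z [].
rewrite (_ : [set _ | _] =
  [set z : Rd R d | dist_set (G `&` C) z == dist_set G z]); last first.
  by apply/seteqP; split => z /=; [move=> [_ ->]|move=> /eqP].
rewrite -[X in measurable X]setTI.
exact: (measurable_fun_eqr (measurable_dist_set GC0) (measurable_dist_set G0)
  measurableT (Y := [set true]) I).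
Qed.

(** Two different nearest points lie in disjoint cubes of the countable family, and having a nearest
    point in a given cube is a Borel condition. *)
Lemma skelE G : G !=set0 -> compact G ->
  skel G = \bigcup_(t in [set t : 'rV[rat]_d * 'rV[rat]_d * nat |
      qbox t.1.1 t.2 `&` qbox t.1.2 t.2 = set0])
    ([set z | G `&` qbox t.1.1 t.2 !=set0 /\
              dist_set (G `&` qbox t.1.1 t.2) z = dist_set G z] `&`
     [set z | G `&` qbox t.1.2 t.2 !=set0 /\
              dist_set (G `&` qbox t.1.2 t.2) z = dist_set G z]).
Proof.
move=> G0 cG; apply/seteqP; split => z; last first.
  move=> [[[p q] n] /= pq0] [].
  move=> /(dist_set_subset_eq _ G0 cG (@closed_qbox _ _)) [x [Gx px] zx].
  move=> /(dist_set_subset_eq _ G0 cG (@closed_qbox _ _)) [y [Gy qy] zy].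
  have xy : x <> y.
    move=> xy; suff : (qbox p n `&` qbox q n) x by rewrite pq0.
    by split=> //; rewrite xy.
  by exists x, y.
move=> [x [y [Gx [Gy [xy [zx zy]]]]]].
have [i xyi] : exists i, x ord0 i != y ord0 i.
  apply: contrapT => h; apply: xy; apply/rowP => i; apply/eqP.
  by apply: contrapT => /negP xyi; apply: h; exists i.
(* With side below half the gap in coordinate [i], no point can lie in a cube around [x] and in one
   around [y]. *)
have e0 : 0 < `|x ord0 i - y ord0 i| / 2 by rewrite divr_gt0// normr_gt0 subr_eq0.
have [n ne] := natSinv_lt e0.
have [p px] := qbox_cover x n.
have [q qy] := qbox_cover y n.
exists (p, q, n) => /=.
  apply/seteqP; split => // w [pw qw].
  move: (qbox_diam i px pw) (qbox_diam i qw qy) => h1 h2.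
  have h3 := ler_distD (w ord0 i) (x ord0 i) (y ord0 i).
  have := le_lt_trans (le_trans h3 (lerD h1 h2)) (ltrD ne ne).
  by rewrite -splitr ltxx.
split; apply/(dist_set_subset_eq _ G0 cG (@closed_qbox _ _)).
  by exists x.
by exists y.
Qed.

Lemma measurable_skel G : G !=set0 -> compact G ->
  measurable (skel G : set (Rd R d)).
Proof.
move=> G0 cG; rewrite skelE// bigcup_mkcond.
apply: countable_bigcupT_measurable; first exact: countableP.
move=> t; case: ifP => // _.
by apply: measurableI; apply: measurable_nearest_in => //; exact: closed_qbox.
Qed.

(** Off the skeleton the nearest point is in the open set [C] exactly when no nearest point is in
    its closed complement, and that is a comparison of distances. *)
Lemma measurable_nearest_pt G : G !=set0 -> compact G ->
  measurable_fun (~` skel G : set (Rd R d)) (nearest_pt G : Rd R d -> Rd R d).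
Proof.
move=> G0 cG.
apply: (@measurability _ _ (Rd R d) (Rd R d) _ _ (@open 'rV[R]_d) erefl).
move=> _ [C oC <-].
have -> : ~` skel G `&` nearest_pt G @^-1` C =
   ~` skel G `\` [set z | G `&` ~` C !=set0 /\ dist_set (G `&` ~` C) z = dist_set G z].
  apply/seteqP; split => z /= [nsk h]; split => //.
    move=> /(dist_set_subset_eq _ G0 cG (open_closedC oC)) [x [Gx nCx] zx].
    by apply: nCx; rewrite -(nearest_pt_uniq G0 cG nsk Gx zx).
  apply: contrapT => nC; apply: h.
  apply/(dist_set_subset_eq _ G0 cG (open_closedC oC)).
  by have [Gp zp] := nearest_ptP z G0 cG; exists (nearest_pt G z).
apply: measurableD; first by apply: measurableC; exact: measurable_skel.
by apply: measurable_nearest_in => //; exact: open_closedC.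
Qed.

End BorelRd.

(** * Measures and integrals *)

Section MeasureTheory.
Local Open Scope ereal_scope.

(** The integral of a nonnegative function is a supremum over the simple functions below it, so it
    is monotone for arbitrary integrands. This form serves [radial], whose dependence on (x, u) is
    only compared, never analysed. *)
Lemma le_integral_ge0 dT (T : measurableType dT) (R : realType)
    (m : {measure set T -> \bar R}) (D : set T) (f g : T -> \bar R) :
  (forall x, D x -> 0 <= f x) -> (forall x, D x -> f x <= g x) ->
  \int[m]_(x in D) f x <= \int[m]_(x in D) g x.
Proof.
move=> f0 fg.
have g0 x : D x -> 0 <= g x by move=> Dx; exact: le_trans (f0 _ Dx) (fg _ Dx).
rewrite !ge0_integralE//; apply: le_ereal_sup => _ [h hf <-]; exists h => //.
by move=> x; apply: le_trans (hf x) _; exact: lee_restrict.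
Qed.

(** [k] times the image of Lebesgue measure under multiplication by [k] gives half-open intervals
    their length, hence is Lebesgue measure by uniqueness. *)
Lemma lebesgue_measure_scale (R : realType) (k : R) (A : set (measurableTypeR R)) :
  (0 < k)%R -> measurable A ->
  lebesgue_measure ((fun x : measurableTypeR R => k * x)%R @^-1` A) =
  (k^-1)%:E * lebesgue_measure A.
Proof.
move=> k0 mA.
pose kx := (fun x : measurableTypeR R => k * x : measurableTypeR R)%R.
have mk : measurable_fun setT kx by exact: measurable_funM.
pose m := mscale (NngNum (ltW k0)) (pushforward (@lebesgue_measure R) kx).
have -> : lebesgue_measure A = m mk A.
  apply: (@lebesgue_measure_unique R (m mk)) => // _ [[a b] _ <-]/=.
  rewrite /m /mscale/= /pushforward.
  have -> : (fun x => k * x)%R @^-1` `]a, b] = `](a / k)%R, (b / k)%R]%classic.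
    apply/seteqP; split => x /=; rewrite !in_itv/=;
    by rewrite ltr_pdivrMr// ler_pdivlMr// ![(x * k)%R]mulrC.
  rewrite !lebesgue_measure_itv/= !lte_fin ltr_pM2r ?invr_gt0//.
  case: ifP => _; last by rewrite mule0.
  by rewrite -!EFinB -EFinM -mulrBl mulrC divfK// gt_eqF.
rewrite /m /mscale/= /pushforward muleA -EFinM mulVf ?gt_eqF// mul1e.
by [].
Qed.

Lemma integral_null_measure dT (T : measurableType dT) (R : realType)
    (m : {measure set T -> \bar R}) (D : set T) (f : T -> \bar R) :
  (forall A, measurable A -> m A = 0) -> \int[m]_(x in D) f x = 0.
Proof.
move=> m0; rewrite (@eq_measure_integral _ _ _ _ mzero)//.
  exact: integral_measure_zero.
by move=> A mA _; exact: m0.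
Qed.

Lemma measurable_section d1 d2 (T1 : measurableType d1) (T2 : measurableType d2)
    (C : set (T1 * T2)) (y : T2) :
  measurable C -> measurable [set x | C (x, y)].
Proof.
move=> /(measurable_ysection y); congr measurable.
by apply/seteqP; split => x; rewrite /ysection/= inE.
Qed.

Lemma measurable_fun_section d1 d2 (T1 : measurableType d1) (T2 : measurableType d2)
    (R : realType) (m : {sigma_finite_measure set T1 -> \bar R}) (C : set (T1 * T2)) :
  measurable C -> measurable_fun setT (fun y => m [set x | C (x, y)]).
Proof.
move=> /(measurable_fun_ysection m); congr measurable_fun.
apply/funext => y /=; congr (m _).
by apply/seteqP; split => x; rewrite /ysection/= inE.
Qed.

(** Used in both directions for [f] and [fbar \o nearest_pt F]. The error is taken over the larger
    set [D] so that it is the quantity controlled by the approximation hypothesis, whatever [A]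
    is. *)
Lemma le_integral_dist dT (T : measurableType dT) (R : realType)
    (m : {measure set T -> \bar R}) (A D : set T) (f g : T -> R) :
  measurable A -> measurable D -> A `<=` D ->
  measurable_fun D f -> measurable_fun D g ->
  (forall x, D x -> 0 <= f x)%R -> (forall x, D x -> 0 <= g x)%R ->
  \int[m]_(x in A) (f x)%:E <=
  \int[m]_(x in A) (g x)%:E + \int[m]_(x in D) (`|f x - g x|)%:E.
Proof.
move=> mA mD AD mf mg f0 g0.
have mfg : measurable_fun D (fun x => (`|f x - g x|)%:E).
  apply/measurable_EFinP; apply: measurableT_comp => //; exact: measurable_funB.
apply: (@le_trans _ _ (\int[m]_(x in A) (g x)%:E + \int[m]_(x in A) (`|f x - g x|)%:E)).
  rewrite -ge0_integralD//; last 3 first.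
  - by move=> x Ax; rewrite lee_fin g0//; exact: AD.
  - by apply/measurable_EFinP; exact: measurable_funS mg.
  - exact: measurable_funS mfg.
  apply: le_integral_ge0 => x Ax; first by rewrite lee_fin f0//; exact: AD.
  by rewrite -EFinD lee_fin -lerBlDl ler_norm.
by apply: leeD => //; apply: ge0_subset_integral.
Qed.

(** The arithmetic of the final squeeze: [If] and [Ih] stand for the integrals of [f] and of
    [fbar \o nearest_pt F], [Er] for their discrepancy, [Q] and [QB] for the Q-measures of the
    magnified set and of the derivative. Only [QB] is assumed finite, so the inequalities are
    additive. *)
Lemma derivative_bounds (R : realType) (e K : R) (If Ih Er Q QB delta : \bar R) :
  (0 < e)%R -> (0 <= K)%R -> 0 <= If -> 0 <= Ih -> 0 <= Er -> 0 <= Q -> 0 <= delta ->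
  QB \is a fin_num ->
  If <= Ih + Er -> Ih <= If + Er ->
  Ih <= e%:E * Q + (e ^+ 2 * K)%:E -> e%:E * Q <= Ih + (e ^+ 2 * K)%:E ->
  Q <= QB + delta -> QB <= Q + delta ->
  QB - (delta + (e * K)%:E + (e^-1)%:E * Er) <= If * (e^-1)%:E
    <= QB + (delta + (e * K)%:E + (e^-1)%:E * Er).
Proof.
move=> e0 K0 If0 Ih0 Er0 Q0 de0 QBf IfIh IhIf IhQ QIh QQB QBQ.
set E := delta + (e * K)%:E + (e^-1)%:E * Er.
have ei0 : 0 <= (e^-1)%:E by rewrite lee_fin invr_ge0 ltW.
have eK0 : 0 <= (e ^+ 2 * K)%:E by rewrite lee_fin mulr_ge0// exprn_ge0// ltW.
have eQ0 : 0 <= e%:E * Q by rewrite mule_ge0// lee_fin ltW.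
have eeK : (e^-1)%:E * (e ^+ 2 * K)%:E = (e * K)%:E.
  by rewrite -EFinM expr2 -!mulrA mulKf ?gt_eqF.
have eeQ : (e^-1)%:E * (e%:E * Q) = Q.
  by rewrite muleA -EFinM mulVf ?gt_eqF// mul1e.
have E0 : 0 <= E.
  by rewrite !adde_ge0// ?mule_ge0// lee_fin mulr_ge0// ltW.
apply/andP; split; last first.
  have : If <= (e%:E * Q + (e ^+ 2 * K)%:E) + Er.
    by apply: le_trans IfIh _; exact: leeD.
  move/(lee_wpmul2l ei0); rewrite ge0_muleDr ?adde_ge0// ge0_muleDr// eeQ eeK.
  rewrite muleC => /le_trans; apply; rewrite /E !addeA.
  by do 2 apply: leeD => //.
have QL : QB <= If * (e^-1)%:E + E.
  have : e%:E * Q <= (If + Er) + (e ^+ 2 * K)%:E.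
    by apply: le_trans QIh _; exact: leeD.
  move/(lee_wpmul2l ei0); rewrite eeQ ge0_muleDr ?adde_ge0// ge0_muleDr// eeK.
  move=> QL; apply: le_trans QBQ _; apply: le_trans (leeD QL (lexx _)) _.
  rewrite [If * _]muleC /E -!addeA; apply: leeD => //.
  by rewrite [leLHS]addeC [(e * K)%:E + delta]addeC -addeA.
(* An infinite error makes the lower bound [-oo]; only for a finite one may it be moved across. *)
case: E E0 QL => [r| |] E0 QL.
- by rewrite leeBlDr.
- by case: QB QBf {QBQ QQB QL} => // q _; rewrite leNye.
- by [].
Qed.

End MeasureTheory.

(** * Reach function and local magnification *)

Section ReachFunction.
Context {R : realType} {d : nat}.
Variable F : set 'rV[R]_d.
Hypotheses (F0 : F !=set0) (cF : compact F).
Implicit Types (x u z : 'rV[R]_d) (A : set 'rV[R]_d) (e s t : R).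

Lemma dist_set0 z : F z -> dist_set F z = 0.
Proof.
move=> Fz; apply/eqP; rewrite eq_le dist_set_ge0// andbT.
by rewrite -[leRHS](@enorm0 R d) -(subrr z) dist_set_le.
Qed.

Lemma not_skel z : F z -> ~ skel F z.
Proof.
move=> Fz [x [y [Fx [Fy [xy]]]]]; rewrite dist_set0// => -[zx zy]; apply: xy.
move/eqP: (enorm_eq0 zx); rewrite subr_eq0 => /eqP <-.
by move/eqP: (enorm_eq0 zy); rewrite subr_eq0 => /eqP.
Qed.

(** Supplies the compact supports required of test functions in the Steiner formula. Points of the
    parallel set lie within [c] of [F], whose norms are bounded by that of [x0]. *)
Lemma compact_parallel c : compact (parallel F c).
Proof.
have [x0] : exists2 x, x \in F & forall y, y \in F -> enorm y <= enorm x.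
  by apply: compact_EVT_max => //; apply: continuous_subspaceT; exact: continuous_enorm.
rewrite inE => Fx0 maxF; set M := c + enorm x0.
apply: (@subclosed_compact _ _ [set v : 'rV[R]_d | forall i, `[- M, M]%classic (v ord0 i)]).
- have -> : parallel F c = dist_set F @^-1` [set r | r <= c] by [].
  by apply: preimage_closed; [move=> z _; exact: continuous_dist_set|exact: closed_le].
- by apply: (@rV_compact _ _ (fun=> `[- M, M]%classic)) => i; exact: segment_compact.
- move=> z zc i; rewrite /= in_itv/= -ler_norml.
  apply: le_trans (enorm_coord z i) _.
  have [Fp zp] := nearest_ptP z F0 cF.
  rewrite -[z](subrK (nearest_pt F z)); apply: le_trans (enormD _ _) _.
  by rewrite lerD// ?zp//; apply: maxF; rewrite inE.
Qed.

(** The magnification map is inverted by (s, x, u) -> x + (e s) u. The right-hand side no longer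
    mentions an unknown preimage, which is what makes scaling and measurability accessible. *)
Lemma taP e A s x u : 0 < e ->
  tau F e A (s, (x, u)) <->
  [/\ 0 < s, enorm u = 1, F x,
     (A `\` (F `|` skel F)) (x + (e * s) *: u) &
     dist_set F (x + (e * s) *: u) = e * s].
Proof.
move=> e0; split.
  move=> [z [Az nFz] [<- <- <-]].
  have [Fp zp] := nearest_ptP z F0 cF.
  have dz0 : 0 < dist_set F z by apply: dist_set_gt0 => // Fz; apply: nFz; left.
  have es : e * (dist_set F z / e) = dist_set F z by rewrite mulrC divfK// gt_eqF.
  have zE : nearest_pt F z + (e * (dist_set F z / e)) *: unitv F z = z.
    by rewrite es /unitv scalerA divff ?gt_eqF// scale1r addrC subrK.
  rewrite zE es; split => //; first by rewrite divr_gt0.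
  by rewrite /unitv enormZ zp gtr0_norm ?invr_gt0// mulVf// gt_eqF.
move=> [s0 u1 Fx Az ds]; exists (x + (e * s) *: u) => //.
have es0 : 0 < e * s by rewrite mulr_gt0.
have px : nearest_pt F (x + (e * s) *: u) = x.
  apply: nearest_pt_uniq => //; first by move=> sk; apply: Az.2; right.
  by rewrite addrC addKr enormZ u1 mulr1 ds gtr0_norm.
rewrite /unitv px ds; congr (_, (_, _)); first by rewrite mulrAC divff ?mul1r ?gt_eqF.
by rewrite addrC addKr scalerA mulVf ?scale1r// gt_eqF.
Qed.

Lemma tau_scale e A s xu : 0 < e -> tau F e A (s, xu) <-> tau F 1 A (e * s, xu).
Proof.
by case: xu => x u e0; rewrite !taP// mul1r pmulr_rgt0.
Qed.

(** Images of Borel sets are awkward in general; through [taP] this one is an intersection of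
    preimages under Borel maps of (s, x, u). *)
Lemma measurable_tau e A : 0 < e -> measurable (A : set (Rd R d)) ->
  measurable (tau F e A : set (R * (Rd R d * Rd R d))).
Proof.
move=> e0 mA.
pose T := (R * (Rd R d * Rd R d))%type.
have mx i : measurable_fun [set: T] (fun p : T => (p.2.1 : 'rV[R]_d) ord0 i).
  apply: (measurableT_comp (@measurable_coord R d i)).
  by apply: measurableT_comp => //; exact: measurable_fst.
have mu i : measurable_fun [set: T] (fun p : T => (p.2.2 : 'rV[R]_d) ord0 i).
  apply: (measurableT_comp (@measurable_coord R d i)).
  by apply: measurableT_comp => //; exact: measurable_snd.
have ms : measurable_fun [set: T] (fun p : T => p.1) by exact: measurable_fst.
pose phi := fun p : T => (p.2.1 : 'rV[R]_d) + (e * p.1) *: (p.2.2 : 'rV[R]_d).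
have mphi : measurable_fun [set: T] (phi : T -> Rd R d).
  apply: measurable_fun_Rd => i; under eq_fun do rewrite !mxE.
  apply: measurable_funD => //; apply: measurable_funM => //.
  by apply: measurable_funM => //; exact: measurable_cst.
have mF : measurable (F : set (Rd R d)).
  by apply: closed_measurable_Rd; apply: compact_closed => //; exact: norm_hausdorff.
have -> : tau F e A =
  [set p : T | 0 < p.1] `&` [set p : T | enorm (p.2.2 : 'rV[R]_d) == 1] `&`
  [set p : T | F p.2.1] `&` phi @^-1` (A `\` (F `|` skel F)) `&`
  [set p : T | dist_set F (phi p) == e * p.1].
  apply/seteqP; split => -[s [x u]].
    by move=> /(taP _ _ _ _ e0)[s0 u1 Fx Az ds]; split; [split; [split; [split|]|]|] => //=; exact/eqP.
  by move=> [[[[/= s0 /eqP u1] Fx] Az] /eqP ds]; apply/taP.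
have true_meas (b : T -> bool) : measurable_fun [set: T] b -> measurable [set p | b p].
  by move=> mb; have := mb measurableT [set true] I; rewrite setTI.
apply: measurableI; first (apply: measurableI; first (apply: measurableI; first apply: measurableI)).
- by apply: true_meas; apply: measurable_fun_ltr => //; exact: measurable_cst.
- apply: true_meas; apply: measurable_fun_eqr; last exact: measurable_cst.
  apply: (measurableT_comp (@measurable_enorm R d)).
  by apply: measurableT_comp => //; exact: measurable_snd.
- rewrite -[X in measurable X]setTI.
  have mx' : measurable_fun [set: T] (fun p : T => p.2.1).
    by apply: measurableT_comp => //; exact: measurable_fst.
  exact: mx'.
- rewrite -[X in measurable X]setTI; apply: mphi => //.
  by apply: measurableD => //; apply: measurableU => //; exact: measurable_skel.
- apply: true_meas; apply: measurable_fun_eqr.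
    exact: (measurableT_comp (measurable_dist_set F0) mphi).
  by apply: measurable_funM => //; exact: measurable_cst.
Qed.

Lemma NorP x u : Nor F (x, u) <->
  [/\ enorm u = 1, F x & exists s, [/\ 0 < s, ~ skel F (x + s *: u) &
     dist_set F (x + s *: u) = s]].
Proof.
have -> : Nor F (x, u) <-> exists s, tau F 1 setT (s, (x, u)).
  split => [[z nFz [<- <-]]|[s [z [_ nFz] [_ <- <-]]]]; last by exists z.
  by exists (dist_set F z / 1), z.
split => [[s /(taP _ _ _ _ ltr01)]|[u1 Fx [s [s0 nsk ds]]]].
  rewrite mul1r => -[s0 u1 Fx [_ nsk] ds]; split => //; exists s; split => // sk.
  by apply: nsk; right.
exists s; apply/taP => //; rewrite mul1r; split => //; split => // -[|//].
by move/dist_set0; rewrite ds => s00; rewrite s00 ltxx in s0.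
Qed.

(** The bundle is the projection of [tau F 1 setT] along [s], an uncountable union of sections. By
    [nearest_pt_inner] a witness [s] can be lowered to some 1 / (n + 1), so countably many sections
    suffice. *)
Lemma measurable_Nor : measurable (Nor F : set (Rd R d * Rd R d)).
Proof.
have -> : Nor F = \bigcup_n xsection (tau F 1 setT : set (R * (Rd R d * Rd R d))) n.+1%:R^-1.
  apply/seteqP; split => -[x u]; last first.
    move=> [n _]; rewrite /xsection/= inE => -[z [_ nFz] [_ <- <-]].
    by exists z.
  move=> /NorP[u1 Fx [s [s0 nsk ds]]].
  have [n] := ltr_add_invr s0; rewrite add0r => ns.
  exists n => //; rewrite /xsection/= inE; apply/taP => //; rewrite mul1r.
  have ns' : 0 <= (n.+1%:R^-1 : R) <= s by rewrite invr_ge0 ler0n ltW.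
  have [nsk' ds'] := nearest_pt_inner F0 cF u1 ns' Fx nsk ds.
  split => //; split => // -[|//]; move/dist_set0; rewrite ds' => /eqP.
  by rewrite invr_eq0 pnatr_eq0.
apply: bigcupT_measurable => n; apply: measurable_xsection.
by apply: measurable_tau => //; exact: measurableT.
Qed.

(** The supremum defining the reach yields some s > t at which [x] is the unique nearest point, and
    [nearest_pt_inner] carries this down to [t]. *)
Lemma lt_reach x u t : Nor F (x, u) -> 0 < t -> (t%:E < reach F x u)%E ->
  [/\ ~ skel F (x + t *: u), dist_set F (x + t *: u) = t &
     nearest_pt F (x + t *: u) = x].
Proof.
move=> /NorP[u1 Fx _] t0 /ereal_sup_gt[_ [s [s0 [nsk ps]] <-]]; rewrite lte_fin => ts.
have ds : dist_set F (x + s *: u) = s.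
  have [_ <-] := nearest_ptP (x + s *: u) F0 cF.
  by rewrite ps addrC addKr enormZ u1 mulr1 gtr0_norm.
have ts' : 0 <= t <= s by rewrite !ltW.
have [nsk' ds'] := nearest_pt_inner F0 cF u1 ts' Fx nsk ds.
split => //; apply: nearest_pt_uniq => //.
by rewrite addrC addKr enormZ u1 mulr1 gtr0_norm.
Qed.

Lemma tau_reach A x u s : tau F 1 A (s, (x, u)) -> (s%:E <= reach F x u)%E.
Proof.
move=> /(taP _ _ _ _ ltr01); rewrite mul1r => -[s0 u1 Fx [_ nsk] ds].
apply: ereal_sup_ubound; exists s => //; split => //.
have nsk' : ~ skel F (x + s *: u) by move=> sk; apply: nsk; right.
split => //; apply: nearest_pt_uniq => //.
by rewrite ds addrC addKr enormZ u1 mulr1 gtr0_norm.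
Qed.

Lemma lt_reach_tau A x u s : Nor F (x, u) -> 0 < s -> (s%:E < reach F x u)%E ->
  tau F 1 A (s, (x, u)) <-> A (x + s *: u).
Proof.
move=> N s0 sr; have [nsk ds ps] := lt_reach N s0 sr.
have [u1 Fx _] := (NorP x u).1 N.
rewrite taP// mul1r; split => [[_ _ _ []]//|Az]; split => //; split => // -[|//].
by move/dist_set0; rewrite ds => s00; rewrite s00 ltxx in s0.
Qed.

Lemma measurable_below_reach x u :
  measurable [set t : measurableTypeR R | 0 < t /\ (t%:E < reach F x u)%E].
Proof.
case: (reach F x u) => [r| |].
- have -> : [set t | 0 < t /\ (t%:E < r%:E)%E] = `]0, r[%classic.
    by apply/seteqP; split => t /=; rewrite in_itv/= lte_fin; [move=> [-> ->]|move=> /andP[]].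
  exact: measurable_itv.
- have -> : [set t : R | 0 < t /\ (t%:E < +oo)%E] = `]0, +oo[%classic.
    by apply/seteqP; split => t /=; rewrite in_itv/= andbT ltry; [move=> []|].
  exact: measurable_itv.
- rewrite (_ : [set t | _] = set0)//; apply/seteqP; split => t //= -[_].
  by rewrite ltNge leNye.
Qed.

Lemma lebesgue_tau_section e A x u : 0 < e -> measurable (A : set (Rd R d)) ->
  Nor F (x, u) ->
  (lebesgue_measure [set s | tau F e A (s, (x, u))] =
   (e^-1)%:E * lebesgue_measure ([set s | tau F 1 A (s, (x, u))] `&`
      [set t : R | (0 < t)%R /\ (t%:E < reach F x u)%E]))%E.
Proof.
move=> e0 mA N.
have mS : measurable [set s : measurableTypeR R | tau F 1 A (s, (x, u))].
  exact: measurable_section (measurable_tau ltr01 mA).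
have -> : [set s | tau F e A (s, (x, u))] =
  (fun s => e * s) @^-1` [set s | tau F 1 A (s, (x, u))].
  by apply/seteqP; split => s; have [] := tau_scale A s (x, u) e0.
rewrite lebesgue_measure_scale//; congr (_ * _)%E.
set S := [set s | _] in mS *; set I := [set t | _].
have mI : measurable I by exact: measurable_below_reach.
apply/eqP; rewrite eq_le; apply/andP; split; last first.
  by apply: le_measure; rewrite ?inE//; exact: measurableI.
(* [tau_reach] gives only s <= reach, whereas the Steiner formula integrates over t < reach; the
   difference is at most the endpoint, a null set. If the reach is infinite, the added singleton is
   harmless. *)
have SI : S `<=` (S `&` I) `|` [set fine (reach F x u)].
  move=> s Ss; have := tau_reach Ss; rewrite le_eqVlt => /orP[/eqP <-|sr].
    by right.
  left; split => //; split => //.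
  by have /(taP _ _ _ _ ltr01)[] := Ss.
apply: le_trans (le_measure _ _ _ SI) _; rewrite ?inE//.
  by apply: measurableU; [exact: measurableI|exact: measurable_set1].
apply: (le_trans (@measureU2 _ _ _ _ _ _ _ _)); [exact: measurableI|exact: measurable_set1|].
by rewrite [X in (_ + X)%E]lebesgue_measure_set1 adde0.
Qed.

End ReachFunction.

(** * The local Steiner formula on a parallel set *)

Section LocalSteiner.
Context {R : realType} {d : nat}.
Variables (mu : {measure set (Rd R d) -> \bar R}) (F : set 'rV[R]_d).
Hypothesis HF : boundary_set mu F.
Variables (thP thN : nat -> {measure set (Rd R d * Rd R d)%type -> \bar R}).
Hypothesis Hth : support_measures mu F thP thN.

Let F0 : F !=set0 := HF.1.
Let cF : compact F := HF.2.1.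

(** In dimension 0 the nonempty set [F] would be the whole space and so have interior. This makes d
    - 1 a legitimate index of a support measure. *)
Lemma boundary_set_dim_gt0 : (0 < d)%N.
Proof.
rewrite lt0n; apply/eqP => d0; have [x Fx] := F0.
have FT : F = setT.
  apply/seteqP; split => // y _; suff -> : y = x by [].
  by apply/rowP => i; exfalso; case: i => i; rewrite d0.
by have := HF.2.2.1; rewrite FT interiorT => /seteqP[/(_ x I)].
Qed.

Lemma measurable_boundary : measurable (F : set (Rd R d)).
Proof.
by apply: closed_measurable_Rd; apply: compact_closed => //; exact: norm_hausdorff.
Qed.

Lemma measurable_parallel c : measurable (parallel F c : set (Rd R d)).
Proof.
have cont := continuous_measurable_Rd (continuous_dist_set F0).
have := measurable_fun_ler cont (@measurable_cst _ _ _ _ setT c) measurableT (Y := [set true]) I.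
by rewrite setTI.
Qed.

(* The Steiner formula itself shows that the skeleton is a null set: the rays
   [x + t u] with [t < reach F x u] never meet it. *)
Lemma skel_null c : mu (skel F `&` parallel F c) = 0%E.
Proof.
set S := skel F `&` parallel F c.
have mS : measurable (S : set (Rd R d)).
  by apply: measurableI; [exact: measurable_skel|exact: measurable_parallel].
have [_ [_ /(_ (\1_S))]] := Hth.
have mf : measurable_fun (setT : set (Rd R d)) (\1_S : Rd R d -> R).
  exact: measurable_indic.
move=> /(_ mf) st.
have st1 : exists M : R, forall z, `|\1_S z| <= M.
  by exists 1 => z; rewrite indicE; case: (z \in S); rewrite ?normr1 ?normr0.
have st2 : exists K : set 'rV[R]_d, compact K /\ forall z, ~ K z -> \1_S z = 0 :> R.
  exists (parallel F c); split; first exact: compact_parallel.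
  by move=> z nz; rewrite indicE memNset// => -[].
move: (st st1 st2); rewrite /= integral_indic//; last exact: measurableC measurable_boundary.
have -> : S `&` ~` F = S.
  by apply/seteqP; split => [z []//|z Sz]; split => // /(not_skel F0); apply; exact: Sz.1.
move=> ->; apply: big1 => j _.
have g0 : forall xu, Nor F xu ->
  (\int[lebesgue_measure]_(t in [set t : R | (0 < t)%R /\ t%:E < reach F xu.1 xu.2])
      (\1_S (xu.1 + (t : R) *: xu.2) * (t : R) ^+ (j - 1))%:E)%E = 0%E.
  move=> [x u] N; apply: integral0_eq => t [t0 tr].
  rewrite indicE memNset ?mul0r// => -[sk _].
  by have [/(_ sk)] := lt_reach F0 cF N t0 tr.
by rewrite !integral0_eq// sube0 mule0.
Qed.

Variables (fbar : 'rV[R]_d -> R).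
Hypothesis fbar_meas : measurable_fun (F : set (Rd R d)) fbar.
Hypothesis fbar_ge0 : forall x, F x -> 0 <= fbar x.
Hypothesis fbar_bnd : exists M : R, forall x, F x -> `|fbar x| <= M.
Hypothesis Hint : forall i, (i < d)%N ->
  (thP i).-integrable (Nor F) (fun xu : 'rV[R]_d * 'rV[R]_d => (fbar xu.1)%:E) /\
  (thN i).-integrable (Nor F) (fun xu : 'rV[R]_d * 'rV[R]_d => (fbar xu.1)%:E).

Lemma Nor_fst xu : Nor F xu -> F xu.1.
Proof. by case: xu => x u /(NorP F0 cF)[]. Qed.

Lemma Nor_fbar_ge0 xu : Nor F xu -> 0 <= fbar xu.1.
Proof. by move=> /Nor_fst; exact: fbar_ge0. Qed.

Lemma measurable_fbar_nearest :
  measurable_fun (~` skel F : set (Rd R d)) (fbar \o nearest_pt F).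
Proof.
apply: (@measurable_comp _ _ _ (Rd R d) (Rd R d) R (F : set (Rd R d))) => //.
- exact: measurable_boundary.
- by move=> _ [z _ <-]; exact: (nearest_ptP z F0 cF).1.
- exact: measurable_nearest_pt.
Qed.

Lemma measurable_fbar_nearestS (A : set (Rd R d)) : A `<=` ~` skel F ->
  measurable_fun A (fbar \o nearest_pt F).
Proof.
move=> Ask; apply: measurable_funS measurable_fbar_nearest => //.
by apply: measurableC; exact: measurable_skel.
Qed.

(** [Qmeas] integrates over all pairs, but [fbar] is controlled only on [F]; outside the bundle the
    sections of [B] are empty, so nothing is lost by restricting. *)
Lemma Qmeas_Nor (th : {measure set (Rd R d * Rd R d)%type -> \bar R})
    (B : set (R * (Rd R d * Rd R d))) : (forall s xu, B (s, xu) -> Nor F xu) ->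
  Qmeas th fbar B =
  (\int[th]_(xu in Nor F) ((fbar xu.1)%:E * lebesgue_measure [set s | B (s, xu)]))%E.
Proof.
move=> BN; rewrite /Qmeas [RHS]integral_mkcond; apply: eq_integral => xu _.
rewrite patchE; case: ifPn => // /negP; rewrite inE => nN.
rewrite (_ : [set s | B (s, xu)] = set0) ?measure0 ?mule0//.
by apply/seteqP; split => s // /BN.
Qed.

Lemma tau_Nor e A s xu : tau F e A (s, xu) -> Nor F xu.
Proof. by move=> [z [_ nz] [_ <-]]; exists z. Qed.

(* [nearest_pt F] is the metric projection only off the skeleton, hence the
   cut-off by zero. *)
Definition radial (A : set 'rV[R]_d) (j : nat) (xu : 'rV[R]_d * 'rV[R]_d) : \bar R :=
  (\int[@lebesgue_measure R]_(t in [set t : R | (0 < t)%R /\ t%:E < reach F xu.1 xu.2])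
     (((fbar \o nearest_pt F) \_ (A `\` (F `|` skel F))) (xu.1 + (t : R) *: xu.2)%R
        * (t : R) ^+ (j - 1))%:E)%E.

(** Below the reach the ray avoids [F] and the skeleton and projects back to [x], so [fbar] is
    constant along it. *)
Lemma radial_indic A x u t : Nor F (x, u) -> 0 < t -> (t%:E < reach F x u)%E ->
  ((fbar \o nearest_pt F) \_ (A `\` (F `|` skel F))) (x + t *: u) =
  fbar x * \1_A (x + t *: u).
Proof.
move=> N t0 tr; have [nsk dt pt] := lt_reach F0 cF N t0 tr.
rewrite patchE indicE.
have -> : (x + t *: u \in A `\` (F `|` skel F)) = (x + t *: u \in A).
  apply/idP/idP; rewrite !inE; first by case.
  move=> At; split => // -[|//].
  by move/(dist_set0 F0); rewrite dt => t00; rewrite t00 ltxx in t0.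
by case: ifP => _ /=; rewrite ?pt ?mulr1 ?mulr0.
Qed.

Lemma radial_ge0 A j xu : Nor F xu -> (0 <= radial A j xu)%E.
Proof.
case: xu => x u N; apply: integral_ge0 => t [t0 tr].
rewrite lee_fin (radial_indic _ N t0 tr) mulr_ge0 ?exprn_ge0 ?(ltW t0)//.
by rewrite mulr_ge0// ?(Nor_fbar_ge0 N)// indicE.
Qed.

(** For j = 1 the weight is t ^ 0, leaving [fbar x] times the length of the part of the ray in [A];
    the magnified section has that length divided by [e]. *)
Lemma radial1 e A xu : 0 < e -> measurable (A : set (Rd R d)) -> Nor F xu ->
  (radial A 1 xu =
   e%:E * ((fbar xu.1)%:E * lebesgue_measure [set s | tau F e A (s, xu)]))%E.
Proof.
case: xu => x u e0 mA N; rewrite lebesgue_tau_section//=.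
have mS : measurable [set s : measurableTypeR R | tau F 1 A (s, (x, u))].
  exact: measurable_section (measurable_tau F0 cF ltr01 mA).
set S := [set s | _] in mS *; set J := [set t : R | (0 < t)%R /\ (t%:E < reach F x u)%E].
have mJ : measurable (J : set (measurableTypeR R)) by exact: (@measurable_below_reach _ _ F x u).
rewrite muleCA [X in (_ * X)%E]muleA -EFinM divff ?gt_eqF// mul1e.
rewrite -integral_indic// -ge0_integralZl_EFin//; last 2 first.
- by apply/measurable_EFinP; exact: measurable_indic.
- exact: (Nor_fbar_ge0 N).
apply: eq_integral => t; rewrite inE => -[t0 tr].
rewrite (radial_indic _ N t0 tr) expr0 mulr1 EFinM !indicE.
congr (_ * (_ %:R)%:E)%E; congr nat_of_bool.
by apply/idP/idP; rewrite !inE => /(lt_reach_tau F0 cF A N t0 tr).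
Qed.

(** Below the reach [t] is the distance to [F], so t <= c on [A]. The integrand is then at most fbar
    x * c ^ (j - 1), on an interval of length [c]. *)
Lemma radial_le A c j xu : 0 < c -> (1 <= j)%N -> A `<=` parallel F c -> Nor F xu ->
  (radial A j xu <= (c ^+ j)%:E * (fbar xu.1)%:E)%E.
Proof.
case: xu => x u c0 j1 Ac N.
set J := [set t : R | (0 < t)%R /\ (t%:E < reach F x u)%E].
have mJ : measurable (J : set (measurableTypeR R)) by exact: (@measurable_below_reach _ _ F x u).
have mc : measurable (`[0, c] : set (measurableTypeR R)) by exact: measurable_itv.
apply: (@le_trans _ _ (\int[lebesgue_measure]_(t in J)
    ((fbar x * c ^+ (j - 1))%:E * (\1_`[0, c]%classic t)%:E))%E).
  apply: le_integral_ge0 => t [t0 tr]; rewrite (radial_indic _ N t0 tr).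
    rewrite lee_fin mulr_ge0 ?exprn_ge0 ?(ltW t0)//.
    by rewrite mulr_ge0// ?(Nor_fbar_ge0 N)// indicE.
  rewrite -EFinM lee_fin !indicE.
  have [|_] := boolP (_ \in A); last first.
    rewrite mulr0 mul0r mulr_ge0// mulr_ge0 ?(Nor_fbar_ge0 N)//.
    by rewrite exprn_ge0// ltW.
  rewrite inE => /Ac; rewrite /parallel/=; have [_ -> _] := lt_reach F0 cF N t0 tr => tc.
  rewrite mem_set/= ?in_itv/= ?(ltW t0)// !mulr1.
  rewrite ler_wpM2l ?(Nor_fbar_ge0 N)// lerXn2r ?nnegrE//; exact: ltW.
rewrite ge0_integralZl_EFin//; last 2 first.
- by apply/measurable_EFinP; exact: measurable_indic.
- by rewrite mulr_ge0 ?(Nor_fbar_ge0 N)// exprn_ge0// ltW.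
rewrite integral_indic//.
apply: (@le_trans _ _ ((fbar x * c ^+ (j - 1))%:E * c%:E)%E).
  apply: lee_wpmul2l; first by rewrite lee_fin mulr_ge0 ?(Nor_fbar_ge0 N)// exprn_ge0// ltW.
  apply: le_trans (le_measure _ _ _ (@subIsetl _ _ _)) _; rewrite ?inE//.
    exact: measurableI.
  by rewrite [leLHS]lebesgue_measure_itv/= lte_fin c0 oppr0 addr0.
by rewrite -!EFinM lee_fin -mulrA -exprSr subn1 prednK// mulrC.
Qed.

(** The integral of [fbar] against the total variation of the i-th support measure. *)
Definition fbar_mass (i : nat) : R :=
  fine (\int[thP i]_(xu in Nor F) (fbar xu.1)%:E)%E +
  fine (\int[thN i]_(xu in Nor F) (fbar xu.1)%:E)%E.

(** Produces a real number, so that the contributions of the positive and negative parts can be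
    subtracted. *)
Lemma radial_integral_bound (th : {measure set (Rd R d * Rd R d)%type -> \bar R}) A c j :
  th.-integrable (Nor F) (fun xu : 'rV[R]_d * 'rV[R]_d => (fbar xu.1)%:E) ->
  0 < c -> (1 <= j)%N -> A `<=` parallel F c ->
  exists r, [/\ (\int[th]_(xu in Nor F) radial A j xu = r%:E)%E, 0 <= r &
    r <= c ^+ j * fine (\int[th]_(xu in Nor F) (fbar xu.1)%:E)%E].
Proof.
move=> ith c0 j1 Ac; have mN := measurable_Nor F0 cF.
have ifin := integrable_fin_num mN ith.
have ge0 : (0 <= \int[th]_(xu in Nor F) radial A j xu)%E.
  by apply: integral_ge0 => xu; exact: radial_ge0.
have le : (\int[th]_(xu in Nor F) radial A j xu <=
  (c ^+ j * fine (\int[th]_(xu in Nor F) (fbar xu.1)%:E)%E)%:E)%E.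
  rewrite EFinM fineK// -ge0_integralZl_EFin//; last 3 first.
  - by move=> xu N; rewrite lee_fin; exact: Nor_fbar_ge0.
  - exact: measurable_int ith.
  - by rewrite exprn_ge0// ltW.
  by apply: le_integral_ge0 => xu N; [exact: radial_ge0|exact: radial_le].
have fin : (\int[th]_(xu in Nor F) radial A j xu)%E \is a fin_num.
  by rewrite ge0_fin_numE// (le_lt_trans le)// ltry.
exists (fine (\int[th]_(xu in Nor F) radial A j xu)%E); split.
- by rewrite fineK.
- exact: fine_ge0.
- by rewrite -lee_fin fineK.
Qed.

(** [e] enters only through the exact rescaling of the first-order term. The formula is later used
    with c = e T, where the bound on [r] has only powers of [e] from the second on. *)
Lemma local_steiner e A c : 0 < e -> 0 < c -> measurable (A : set (Rd R d)) ->
  A `<=` parallel F c ->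
  exists2 r : R,
    `|r| <= \sum_(2 <= j < d.+1) 'C(d - 1, j - 1)%:R * (c ^+ j * fbar_mass (d - j)%N) &
    (\int[mu]_(z in A `\` (F `|` skel F)) (fbar (nearest_pt F z))%:E =
     e%:E * Qmeas (thP d.-1) fbar (tau F e A) + r%:E)%E.
Proof.
move=> e0 c0 mA Ac; have d0 := boundary_set_dim_gt0.
have mF := measurable_boundary.
set A' := A `\` (F `|` skel F).
have mA' : measurable (A' : set (Rd R d)).
  by apply: measurableD => //; apply: measurableU => //; exact: measurable_skel.
pose h := (fbar \o nearest_pt F) \_ A'.
have [_ [thN0 /(_ h)]] := Hth.
have mh : measurable_fun (setT : set (Rd R d)) (h : Rd R d -> R).
  apply: (proj1 (@measurable_restrictT _ _ (Rd R d) R A' _ mA')).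
  by apply: measurable_fbar_nearestS => z [_ nz] sk; apply: nz; right.
move=> /(_ mh) st.
have st1 : exists M : R, forall z, `|h z| <= M.
  have [M MF] := fbar_bnd; exists `|M| => z; rewrite /h patchE; case: ifP => _.
    apply: le_trans (ler_norm M); apply: MF; exact: (nearest_ptP z F0 cF).1.
  by rewrite normr0.
have st2 : exists K : set 'rV[R]_d, compact K /\ forall z, ~ K z -> h z = 0.
  exists (parallel F c); split; first exact: compact_parallel.
  by move=> z nz; rewrite /h patchE memNset// => -[/Ac].
move: (st st1 st2) => {st st1 st2} /=.
have -> : (\int[mu]_(z in ~` F) (h z)%:E =
           \int[mu]_(z in A') (fbar (nearest_pt F z))%:E)%E.
  have -> : A' = ~` F `&` A'.
    by apply/seteqP; split => [z A'z|z []//]; split => // Fz; apply: A'z.2; left.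
  rewrite integral_mkcondr; apply: eq_integral => z _.
  by rewrite /h !patchE; case: ifP.
move=> ->.
set Sg := (X in exists2 r, _ & X = _).
(* At j = 1 the binomial coefficient is 1, and the negative part of index d - 1 is the zero
   measure. *)
have -> : Sg = (\int[thP d.-1]_(xu in Nor F) radial A 1 xu +
    \sum_(2 <= j < d.+1) ('C(d - 1, j - 1)%:R%:E *
      (\int[thP (d - j)%N]_(xu in Nor F) radial A j xu
       - \int[thN (d - j)%N]_(xu in Nor F) radial A j xu)))%E.
  rewrite /Sg big_ltn ?ltnS// subnn bin0 mul1e subn1.
  rewrite [X in (_ - X)%E]integral_null_measure ?sube0//; exact: thN0.
(* The range condition sits under the existential so that [r] can be chosen as a function of every
   [j]; outside the range 0 is taken. *)
have exr j : exists r : R, (2 <= j < d.+1)%N ->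
   `|r| <= 'C(d - 1, j - 1)%:R * (c ^+ j * fbar_mass (d - j)%N) /\
   ('C(d - 1, j - 1)%:R%:E * (\int[thP (d - j)%N]_(xu in Nor F) radial A j xu
      - \int[thN (d - j)%N]_(xu in Nor F) radial A j xu) = r%:E)%E.
  have [/andP[j2 jd]|] := boolP (2 <= j < d.+1)%N; last by exists 0.
  have dj : (d - j < d)%N by rewrite ltn_subrL d0 (ltn_trans _ j2).
  have [iP iN] := Hint dj.
  have j1 : (1 <= j)%N by exact: ltnW.
  have [p [-> p0 pc]] := radial_integral_bound iP c0 j1 Ac.
  have [n [-> n0 nc]] := radial_integral_bound iN c0 j1 Ac.
  exists ('C(d - 1, j - 1)%:R * (p - n)) => _; split; last by rewrite -EFinB -EFinM.
  rewrite normrM ger0_norm// ler_wpM2l// mulrDr.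
  apply: le_trans (ler_normB _ _) _.
  by rewrite !ger0_norm// lerD.
pose r j := sval (cid (exr j)).
have rP j := svalP (cid (exr j)).
exists (\sum_(2 <= j < d.+1) r j).
  apply: le_trans (ler_norm_sum _ _ _) _.
  apply: ler_sum_nat => j jd.
  by have [] := rP j jd.
congr (_ + _)%E.
  rewrite Qmeas_Nor; last by move=> s xu; exact: tau_Nor.
  rewrite -ge0_integralZl_EFin//; last 4 first.
  - exact: measurable_Nor.
  - by move=> xu N; rewrite mule_ge0// lee_fin; exact: Nor_fbar_ge0.
  - apply: emeasurable_funM.
      have d1d : (d.-1 < d)%N by rewrite prednK.
      exact: measurable_int (Hint d1d).1.
    apply: measurable_funTS; apply: measurable_fun_section.
    exact: measurable_tau.
  - exact: ltW.
  by apply: eq_integral => xu; rewrite inE => N; rewrite -radial1.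
rewrite -sumEFin big_nat_cond [RHS]big_nat_cond; apply: eq_bigr => j /andP[jd _].
by have [_ <-] := rP j jd.
Qed.

End LocalSteiner.

(** * Differentiation *)

Section Differentiation.
Context {R : realType} {d : nat}.
Variables (mu : {measure set (Rd R d) -> \bar R}) (F : set 'rV[R]_d).
Hypothesis HF : boundary_set mu F.

Let F0 : F !=set0 := HF.1.
Let cF : compact F := HF.2.1.

Variables (fbar : 'rV[R]_d -> R).
Hypothesis fbar_meas : measurable_fun (F : set (Rd R d)) fbar.
Hypothesis fbar_ge0 : forall x, F x -> 0 <= fbar x.

Local Open Scope ereal_scope.

(** Each section of [B1] is covered by those of [B2] and of the symmetric difference, and [fbar] is
    at most [M] on the latter. With the two sets exchanged it yields the reverse estimate, and no
    possibly infinite values are subtracted. *)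
Lemma Qmeas_le (th : {measure set (Rd R d * Rd R d)%type -> \bar R}) (M : R)
    (B1 B2 : set (R * (Rd R d * Rd R d))) :
  measurable_fun (Nor F : set (Rd R d * Rd R d))
    (fun xu : 'rV[R]_d * 'rV[R]_d => (fbar xu.1)%:E) ->
  (0 <= M)%R -> (forall x, F x -> (fbar x <= M)%R) ->
  measurable B1 -> measurable B2 ->
  (forall s xu, B1 (s, xu) -> Nor F xu) -> (forall s xu, B2 (s, xu) -> Nor F xu) ->
  Qmeas th fbar B1 <= Qmeas th fbar B2 + M%:E * MF th ((B1 `\` B2) `|` (B2 `\` B1)).
Proof.
move=> mfb M0 fM mB1 mB2 N1 N2; rewrite !(@Qmeas_Nor _ _ F)//.
set D := (B1 `\` B2) `|` (B2 `\` B1).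
have mD : measurable D by apply: measurableU; exact: measurableD.
have mN := measurable_Nor F0 cF.
have msec (C : set (R * (Rd R d * Rd R d))) : measurable C ->
    measurable_fun setT (fun xu : Rd R d * Rd R d => lebesgue_measure [set s | C (s, xu)]).
  by move=> mC; exact: (measurable_fun_section lebesgue_measure mC).
have -> : M%:E * MF th D =
    \int[th]_xu (M%:E * lebesgue_measure [set s | D (s, xu)]).
  by rewrite ge0_integralZl_EFin//; exact: msec.
apply: (@le_trans _ _ (\int[th]_(xu in Nor F)
    ((fbar xu.1)%:E * lebesgue_measure [set s | B2 (s, xu)]) +
    \int[th]_(xu in Nor F) (M%:E * lebesgue_measure [set s | D (s, xu)]))).
  rewrite -ge0_integralD//; last 4 first.
  - by move=> xu N; rewrite mule_ge0// lee_fin; exact: (Nor_fbar_ge0 HF fbar_ge0).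
  - by apply: emeasurable_funM => //; apply: measurable_funTS; exact: msec.
  - by move=> xu _; rewrite mule_ge0.
  - by apply: emeasurable_funM => //; apply: measurable_funTS; exact: msec.
  apply: le_integral_ge0 => xu N.
    by rewrite mule_ge0// lee_fin; exact: (Nor_fbar_ge0 HF fbar_ge0).
  have f0 : (0 <= (fbar xu.1)%:E)%E by rewrite lee_fin; exact: (Nor_fbar_ge0 HF fbar_ge0).
  apply: (@le_trans _ _ ((fbar xu.1)%:E * (lebesgue_measure [set s | B2 (s, xu)] +
      lebesgue_measure [set s | D (s, xu)]))).
    apply: lee_wpmul2l => //.
    have ms (C : set (R * (Rd R d * Rd R d))) : measurable C ->
      measurable [set s : measurableTypeR R | C (s, xu)] by move=> mC; exact: measurable_section mC.
    apply: le_trans (@measureU2 _ _ _ (@lebesgue_measure R) _ _ (ms _ mB2) (ms _ mD)).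
    apply: le_measure; rewrite ?inE; [exact: ms|by apply: measurableU; exact: ms|].
    move=> s B1s; have [B2s|nB2s] := pselect (B2 (s, xu)); first by left.
    by right; left.
  rewrite ge0_muleDr//; apply: leeD => //; apply: lee_wpmul2r => //.
  by rewrite lee_fin fM//; exact: (Nor_fst HF).
apply: leeD => //; apply: ge0_subset_integral => //.
  by apply: emeasurable_funM => //; exact: msec.
by move=> xu _; rewrite mule_ge0.
Qed.

(** Sections of [B] lie in [-T, T], so the measure is at most 2 T times the integral of [fbar].
    Finiteness is what permits subtraction in the squeeze. *)
Lemma Qmeas_fin (th : {measure set (Rd R d * Rd R d)%type -> \bar R}) (T : R)
    (B : set (R * (Rd R d * Rd R d))) :
  th.-integrable (Nor F) (fun xu : 'rV[R]_d * 'rV[R]_d => (fbar xu.1)%:E) ->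
  (0 < T)%R -> measurable B -> B `<=` SigmaT F T -> Qmeas th fbar B \is a fin_num.
Proof.
move=> ith T0 mB BT.
have mN := measurable_Nor F0 cF.
rewrite (@Qmeas_Nor _ _ F); last by move=> s xu /BT[].
have le : \int[th]_(xu in Nor F) ((fbar xu.1)%:E * lebesgue_measure [set s | B (s, xu)])
    <= (T + T)%:E * \int[th]_(xu in Nor F) (fbar xu.1)%:E.
  rewrite -ge0_integralZl_EFin//; last 3 first.
  - by move=> xu N; rewrite lee_fin; exact: (Nor_fbar_ge0 HF fbar_ge0).
  - exact: measurable_int ith.
  - by rewrite addr_ge0 ?ltW.
  apply: le_integral_ge0 => xu N.
    by rewrite mule_ge0// lee_fin; exact: (Nor_fbar_ge0 HF fbar_ge0).
  rewrite muleC; apply: lee_wpmul2r.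
    by rewrite lee_fin; exact: (Nor_fbar_ge0 HF fbar_ge0).
  apply: (@le_trans _ _ (lebesgue_measure `[(- T)%R, T]%classic)).
    apply: le_measure; rewrite ?inE; [exact: measurable_section mB|exact: measurable_itv|].
    by move=> s /BT[/= sT _]; rewrite in_itv/= -ler_norml.
  rewrite [leLHS]lebesgue_measure_itv/= lte_fin; case: ifP => _.
    by rewrite -EFinB opprK.
  by rewrite lee_fin addr_ge0 ?ltW.
rewrite ge0_fin_numE.
  apply: le_lt_trans le _; rewrite lte_mul_pinfty ?lee_fin ?addr_ge0 ?ltW//.
  by rewrite -ge0_fin_numE ?integrable_fin_num//; apply: integral_ge0 => xu N;
    rewrite lee_fin; exact: (Nor_fbar_ge0 HF fbar_ge0).
by apply: integral_ge0 => xu N; rewrite mule_ge0// lee_fin; exact: (Nor_fbar_ge0 HF fbar_ge0).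
Qed.

End Differentiation.

Lemma cvg_at_right0_mulr (R : realType) (T : R) : 0 < T ->
  (fun e => e * T) @ 0^'+ --> 0^'+.
Proof.
move=> T0 P [r /= r0 rP]; exists (r / T) => /=; first by rewrite divr_gt0.
move=> e /=; rewrite sub0r normrN => er e0; apply: rP => /=; last by rewrite mulr_gt0.
by rewrite sub0r normrN normrM (gtr0_norm T0) -ltr_pdivlMr.
Qed.

Unset Implicit Arguments.
Set Strict Implicit.

Theorem theorem6 (R : realType) (d : nat)
  (mu : {measure set (Rd R d) -> \bar R}) (Hmu : is_lebesgue mu)
  (F : set 'rV[R]_d) (HF : boundary_set mu F)
  (f : 'rV[R]_d -> R) (f_meas : measurable_fun (setT : set (Rd R d)) f)
  (f_ge0 : forall z, 0 <= f z)
  (fbar : 'rV[R]_d -> R)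
  (fbar_meas : measurable_fun (F : set (Rd R d)) fbar)
  (fbar_ge0 : forall x, F x -> 0 <= fbar x)
  (fbar_bnd : exists M : R, forall x, F x -> `|fbar x| <= M)
  (Happrox : (fun e : R =>
       ((e^-1)%:E * \int[mu]_(z in [set z | (dist_set F z <= e)%R /\ ~ skel F z])
                      (`|f z - fbar (nearest_pt F z)|%R)%:E)%E) @ 0^'+ --> 0%E)
  (thP thN : nat -> {measure set (Rd R d * Rd R d)%type -> \bar R})
  (Hth : support_measures mu F thP thN)
  (Hint : forall i, (i < d)%N ->
     (thP i).-integrable (Nor F) (fun xu : 'rV[R]_d * 'rV[R]_d => (fbar xu.1)%:E) /\
     (thN i).-integrable (Nor F) (fun xu : 'rV[R]_d * 'rV[R]_d => (fbar xu.1)%:E))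
  (T : R) (T_gt0 : 0 < T)
  (Fam : R -> set 'rV[R]_d)
  (Fam_meas : forall e, 0 <= e <= 1 -> measurable (Fam e : set (Rd R d)))
  (Fam0 : Fam 0 `<=` F)
  (Fam_sub : forall e, 0 <= e <= 1 -> Fam e `<=` parallel F (e * T))
  (B : set (R * (Rd R d * Rd R d)))
  (B_meas : measurable B) (B_sub : B `<=` SigmaT F T)
  (Hdiff : set_differentiable mu (thP d.-1) F Fam B) :
  (fun e : R =>
     ((\int[mu]_(z in Fam e) (f z)%:E - \int[mu]_(z in Fam 0%R) (f z)%:E)
        * (e^-1)%:E)%E) @ 0^'+ --> Qmeas (thP d.-1) fbar B.
Proof.
have [F0 [cF [_ muF0]]] := HF.
have d0 := boundary_set_dim_gt0 HF.
have mF := measurable_boundary HF.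
have mN := measurable_Nor F0 cF.
have msk := measurable_skel F0 cF.
have [M0 fM0] := fbar_bnd; pose M := Num.max M0 0.
have M_ge0 : 0 <= M by rewrite le_max lexx orbT.
have fM x : F x -> fbar x <= M.
  move=> Fx; apply: le_trans (ler_norm _) _; rewrite le_max; apply/orP; left; exact: fM0.
have d1d : (d.-1 < d)%N by rewrite prednK.
have [iP _] := Hint _ d1d.
have mfb := measurable_int _ iP.
pose mass := @fbar_mass _ _ F thP thN fbar.
have mass_ge0 i : 0 <= mass i.
  by rewrite addr_ge0// fine_ge0//; apply: integral_ge0 => xu N; rewrite lee_fin;
    exact: (Nor_fbar_ge0 HF fbar_ge0).
pose K := \sum_(2 <= j < d.+1) 'C(d - 1, j - 1)%:R * (T ^+ j * mass (d - j)%N).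
have K_ge0 : 0 <= K.
  by apply: sumr_ge0 => j _; rewrite !mulr_ge0// exprn_ge0// ltW.
have Fam00 : (\int[mu]_(z in Fam 0%R) (f z)%:E = 0)%E.
  have mFam0 : measurable (Fam 0 : set (Rd R d)) by apply: Fam_meas; rewrite lexx ler01.
  apply: null_set_integral => //; last exact: subset_measure0 muF0.
  by apply/measurable_EFinP; exact: measurable_funTS.
(* The discrepancy is measured on the radius e T, since that parallel set contains [Fam e]. *)
pose Er e := (\int[mu]_(z in [set z | (dist_set F z <= e * T)%R /\ ~ skel F z])
                (`|f z - fbar (nearest_pt F z)|%R)%:E)%E.
pose delta e := (M%:E * MF (thP d.-1) ((tau F e (Fam e) `\` B) `|` (B `\` tau F e (Fam e))))%E.
pose E e := (delta e + (e * K)%:E + (e^-1)%:E * Er e)%E.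
have QBfin : Qmeas (thP d.-1) fbar B \is a fin_num.
  exact: (Qmeas_fin HF fbar_ge0 iP T_gt0 B_meas B_sub).
have E_cvg0 : E e @[e --> 0^'+] --> 0%E.
  rewrite -[X in _ --> X]adde0; apply: cvgeD => //.
    rewrite -[X in _ --> X]adde0; apply: cvgeD => //.
    - have [_ [_ [_ cvMF]]] := Hdiff.
      by rewrite -(mule0 M%:E); apply: cvgeZl.
    - apply: cvg_EFin; first exact: nearW.
      have id0 : e @[e --> (0 : R)^'+] --> (0 : R) by exact: cvg_within.
      have id0K := cvgM id0 (cvg_cst K); rewrite mul0r in id0K; exact: id0K.
  (* At radius e T the hypothesis carries the factor 1 / (e T); multiplying the null limit by [T]
     restores 1 / e. *)
  have ErT := cvg_comp _ _ (cvg_at_right0_mulr T_gt0) Happrox.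
  have Tfin : T%:E \is a fin_num by [].
  have := cvgeZl Tfin ErT; rewrite mule0.
  apply: cvg_trans; apply: near_eq_cvg; near=> e => /=.
  by rewrite muleA -EFinM invfM mulrCA mulfV ?mulr1// gt_eqF.
suff bounds : \forall e \near 0^'+,
    (Qmeas (thP d.-1) fbar B - E e <=
     (\int[mu]_(z in Fam e) (f z)%:E - \int[mu]_(z in Fam 0%R) (f z)%:E) * (e^-1)%:E <=
     Qmeas (thP d.-1) fbar B + E e)%E.
  apply: (squeeze_cvge bounds).
    rewrite -[X in _ --> X]sube0; apply: cvgeB => //; last exact: cvg_cst.
    by rewrite fin_num_adde_defr// oppe0.
  rewrite -[X in _ --> X]adde0; apply: cvgeD => //; last exact: cvg_cst.
  by rewrite fin_num_adde_defl.
near=> e.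
have e0 : 0 < e by [].
have e1 : e <= 1 by near: e; exact: nbhs_right_le.
have e01 : 0 <= e <= 1 by rewrite ltW.
have eT0 : 0 < e * T by rewrite mulr_gt0.
have mA := Fam_meas _ e01; have AT := Fam_sub _ e01.
set A := Fam e in mA AT *; set A' := A `\` (F `|` skel F).
set D := [set z | (dist_set F z <= e * T)%R /\ ~ skel F z].
have mA' : measurable (A' : set (Rd R d)).
  by apply: measurableD => //; exact: measurableU.
have DE : D = parallel F (e * T) `\` skel F by [].
have mD : measurable (D : set (Rd R d)).
  by rewrite DE; apply: measurableD => //; exact: (measurable_parallel HF).
have A'D : A' `<=` D.
  by move=> z [Az nz]; split; [exact: AT|move=> sk; apply: nz; right].
have mfp : measurable_fun (D : set (Rd R d)) (fbar \o nearest_pt F).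
  by apply: (measurable_fbar_nearestS HF) => // z [].
have mfD : measurable_fun (D : set (Rd R d)) f by exact: measurable_funTS.
have fp0 z : 0 <= (fbar \o nearest_pt F) z.
  by apply: fbar_ge0; exact: (nearest_ptP z F0 cF).1.
have intA : (\int[mu]_(z in A) (f z)%:E = \int[mu]_(z in A') (f z)%:E)%E.
  have skn := skel_null HF Hth (e * T).
  (* [skel_null] speaks of the skeleton inside one parallel set; as [A] lies in that of radius e T,
     cutting the skeleton there changes nothing. *)
  have -> : A' = A `\` (F `|` (skel F `&` parallel F (e * T))).
    apply/seteqP; split => z [Az nz]; split => // -[Fz|].
    - by apply: nz; left.
    - by move=> [sk _]; apply: nz; right.
    - by apply: nz; left.
    - by move=> sk; apply: nz; right; split => //; exact: AT.
  have msp : measurable (skel F `&` parallel F (e * T) : set (Rd R d)).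
    by apply: measurableI => //; exact: (measurable_parallel HF).
  apply: ge0_negligible_integral => //.
  - exact: measurableU.
  - by apply/measurable_EFinP; exact: measurable_funTS.
  - by move=> z _; rewrite lee_fin.
  - by rewrite measureU0.
have [r rK stE] := local_steiner HF Hth fbar_meas fbar_ge0 fbar_bnd Hint e0 eT0 mA AT.
(* (e T) ^ j <= e ^ 2 T ^ j because j >= 2 and e <= 1; this is where [K] comes from. *)
have {}rK : `|r| <= e ^+ 2 * K.
  apply: le_trans rK _; rewrite /K mulr_sumr; apply: ler_sum_nat => j /andP[j2 _].
  rewrite [leRHS]mulrCA ler_wpM2l// exprMn -mulrA ler_wpM2r//.
    by rewrite mulr_ge0 ?exprn_ge0 ?mass_ge0// ltW.
  by rewrite ler_wiXn2l// ltW.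
rewrite Fam00 sube0 intA.
have mtau := measurable_tau F0 cF e0 mA.
have MFC : ((B `\` tau F e A) `|` (tau F e A `\` B) = (tau F e A `\` B) `|` (B `\` tau F e A)).
  exact: setUC.
have Qge0 C : (forall s xu, C (s, xu) -> Nor F xu) -> (0 <= Qmeas (thP d.-1) fbar C)%E.
  move=> CN; rewrite (Qmeas_Nor _ _ CN); apply: integral_ge0 => xu N.
  by rewrite mule_ge0// lee_fin; exact: (Nor_fbar_ge0 HF fbar_ge0).
have BN s xu : B (s, xu) -> Nor F xu by move=> /B_sub[].
have tN s xu : tau F e A (s, xu) -> Nor F xu by exact: tau_Nor.
apply: (@derivative_bounds _ e K _
  (\int[mu]_(z in A') ((fbar \o nearest_pt F) z)%:E)%E _
  (Qmeas (thP d.-1) fbar (tau F e A))) => //.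
- by apply: integral_ge0 => z _; rewrite lee_fin.
- by apply: integral_ge0 => z _; rewrite lee_fin fp0.
- by apply: integral_ge0 => z _; rewrite lee_fin.
- exact: Qge0.
- rewrite mule_ge0// /MF; exact: integral_ge0.
- by apply: le_integral_dist.
- rewrite /Er; under [X in (_ + X)%E]eq_integral do rewrite distrC.
  by apply: le_integral_dist.
- rewrite [leLHS]stE; apply: leeD => //; rewrite lee_fin.
  exact: le_trans (ler_norm _) rK.
- have : (e%:E * Qmeas (thP d.-1) fbar (tau F e A) + r%:E - r%:E =
      e%:E * Qmeas (thP d.-1) fbar (tau F e A))%E by rewrite addeK.
  move=> <-; rewrite -stE; apply: leeD => //; rewrite lee_fin.
  by apply: le_trans (ler_norm _) _; rewrite normrN.
- exact: (Qmeas_le HF).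
- by rewrite /delta -MFC; exact: (Qmeas_le HF).
Unshelve. all: by end_near.
Qed.
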